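(* Let $T$ be a tree. Then $T$ admits a linear configuration if and only if $T$ is a path-like tree.
   Context: Path-like trees. Embed the path $P_n$ as a subgraph of a $2$-dimensional grid $P_k\times P_l$. For such an embedding consider the ordered sequence of subpaths $L_1,L_2,\ldots,L_m$ which are maximal straight segments of the embedding, the end of $L_i$ being the beginning of $L_{i+1}$. Suppose $L_i\cong P_2$ for some $i$ and some vertex $u$ of $L_{i-1}$ is at distance $1$ in the grid from a vertex $v$ of $L_{i+1}$. An elementary transformation replaces the edge of $L_i$ by the new edge $uv$. A tree $T$ of order $n$ is a path-like tree if it can be obtained from some embedding of $P_n$ in the $2$-dimensional grid by a sequence of elementary transformations. Linear configuration. A tree $T$ admits a linear configuration if there are paths $P^1_{k_1},\ldots,P^n_{k_n}$ with $V(P^i_{k_i})=\{v^i_1,\ldots,v^i_{k_i}\}$ and $E(P^i_{k_i})=\{v^i_1v^i_2,\ldots,v^i_{k_i-1}v^i_{k_i}\}$ (thought of as placed in this order on a horizontal line), whose vertex sets partition $V(T)$, whose edges are edges of $T$, and such that every other edge of $T$ joins two consecutive paths, i.e. is of the form $v^l_iv^{l+1}_j$ with $1\le l\le n-1$, and moreover: if $v^l_iv^{l+1}_j\in E(T)$ then $d_T(v^l_i,v^l_{k_l})=d_T(v^{l+1}_1,v^{l+1}_j)$ and $j>1$. Here $d_T$ denotes the distance in $T$. *)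

(* Defs.v *)
From mathcomp Require Import all_boot.
From Stdlib Require Import Relation_Operators.

Set Implicit Arguments.
Unset Strict Implicit.
Unset Printing Implicit Defensive.

Section Graphs.
Variables (T : finType) (e : rel T).

Definition simple_graph : Prop := symmetric e /\ irreflexive e.

(* For a symmetric irreflexive e, the duplicate-free e-cycles of length at
   most 2 are the empty one and the edges; longer ones are genuine cycles. *)
Definition is_tree : Prop :=
  [/\ simple_graph,
      0 < #|T|,
      forall x y : T, connect e x y
    & forall c : seq T, ucycle e c -> size c <= 2].

(* Least length of an e-walk from x to y; #|T| if y is unreachable from x. *)
Definition gdist (x y : T) : nat :=
  find (fun n => [exists p : n.-tuple T, path e x p && (last x p == y)])
       (iota 0 #|T|).

End Graphs.

Definition graph_iso (T U : finType) (e : rel T) (g : rel U) : Prop :=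
  exists2 h : T -> U, bijective h & forall x y, g (h x) (h y) = e x y.

Definition path_graph (n : nat) : rel 'I_n :=
  fun i j => (i.+1 == j :> nat) || (j.+1 == i :> nat).

Definition cartesian_product (T U : finType) (e : rel T) (g : rel U) :
    rel (T * U) :=
  fun p q => (p.1 == q.1) && g p.2 q.2 || e p.1 q.1 && (p.2 == q.2).

Definition grid (k l : nat) : rel ('I_k * 'I_l) :=
  cartesian_product (@path_graph k) (@path_graph l).

Definition replace_edge (T : finType) (g : rel T) (a b u v : T) : rel T :=
  fun x y => g x y && ([set x; y] != [set a; b]) || ([set x; y] == [set u; v]).

Section PathLike.
Variables (n k l : nat) (f : 'I_n -> 'I_k * 'I_l).

(* P_n as a (not necessarily induced) subgraph of the grid. *)
Definition path_embedding : Prop :=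
  injective f /\ forall i j, path_graph i j -> grid (f i) (f j).

(* A pair s of indices stands for the subpath f s.1, ..., f s.2. *)
Definition in_segment (s : 'I_n * 'I_n) (i : 'I_n) : bool := s.1 <= i <= s.2.

Definition straight (s : 'I_n * 'I_n) : Prop :=
  s.1 <= s.2 /\
  ((forall i, in_segment s i -> (f i).1 = (f s.1).1) \/
   (forall i, in_segment s i -> (f i).2 = (f s.1).2)).

Definition maximal_straight (s : 'I_n * 'I_n) : Prop :=
  straight s /\
  forall t, straight t -> t.1 <= s.1 -> s.2 <= t.2 -> t = s.

Definition straight_segments (L : seq ('I_n * 'I_n)) : Prop :=
  [/\ uniq L,
      forall s, s \in L <-> maximal_straight s
    & sorted (fun s t => s.2 == t.1) L].

(* The segments L are always those of the embedded path, while g is the current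
   graph on the vertices of the path, which is a path only at the start. *)
Definition elementary_transformation (L : seq ('I_n * 'I_n))
    (g g' : rel 'I_n) : Prop :=
  exists (La Lb Lc : 'I_n * 'I_n) (u v : 'I_n),
    [/\ infix [:: La; Lb; Lc] L,
        Lb.2 = Lb.1.+1 :> nat,
        [/\ in_segment La u, in_segment Lc v
          & gdist (@grid k l) (f u) (f v) = 1],
        g Lb.1 Lb.2 /\ ~~ g u v
      & g' =2 replace_edge g Lb.1 Lb.2 u v].

End PathLike.

Definition path_like (T : finType) (e : rel T) : Prop :=
  exists (n k l : nat) (f : 'I_n -> 'I_k * 'I_l) (L : seq ('I_n * 'I_n))
         (g : rel 'I_n),
    [/\ path_embedding f,
        straight_segments f L,
        clos_refl_trans _ (elementary_transformation f L) (@path_graph n) g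
      & graph_iso g e].

(* v l i is the i-th vertex of the l-th path, which has k l vertices; all
   indices start at 1, and values of k and v out of range are irrelevant. *)
Definition is_linear_configuration (T : finType) (e : rel T)
    (n : nat) (k : nat -> nat) (v : nat -> nat -> T) : Prop :=
  let idx l i := (1 <= l <= n) && (1 <= i <= k l) in
  [/\ forall l, 1 <= l <= n -> 1 <= k l,
      (forall x, exists l i, idx l i /\ v l i = x) /\
      (forall l i l' i', idx l i -> idx l' i' -> v l i = v l' i' ->
         l = l' /\ i = i'),
      forall l i, idx l i -> idx l i.+1 -> e (v l i) (v l i.+1),
      forall x y, e x y -> exists l i,
        (idx l i /\ idx l i.+1 /\ [set x; y] = [set v l i; v l i.+1]) \/
        (exists j, idx l i /\ idx l.+1 j /\ [set x; y] = [set v l i; v l.+1 j])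
    & forall l i j, idx l i -> idx l.+1 j -> e (v l i) (v l.+1 j) ->
        gdist e (v l i) (v l (k l)) = gdist e (v l.+1 1) (v l.+1 j) /\ 1 < j].

Definition admits_linear_configuration (T : finType) (e : rel T) : Prop :=
  exists n k v, @is_linear_configuration T e n k v.

(* Main.v *)
Require Import Defs.
From mathcomp Require Import all_boot zify.
From Stdlib Require Import Relation_Operators.

Set Implicit Arguments.
Unset Strict Implicit.
Unset Printing Implicit Defensive.

(* Both notions describe the same thing: a path 0, ..., N - 1 in which some
   edges {b, b + 1} are replaced by {b - d, b + 1 + d} with d > 0, where no
   other replaced edge lies between b - d and b + 1 + d.
   In a linear configuration of a tree, consecutive paths are joined by exactly
   one edge, and the distance condition centres that edge at the gap between
   them. In an embedded path, an elementary transformation can only join two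
   vertices at equal distance from the edge it removes, and two of them never
   overlap because two grid points have at most two common neighbours.
   Conversely, drawing the pieces between the replaced edges as successive rows,
   run through in alternating directions, puts the ends of each new edge on top
   of each other. *)

(** * Walks and distances *)

Lemma find_iota_min (P : pred nat) (N p : nat) : P p -> find P (iota 0 N) <= p.
Proof.
move=> Pp; case: (ltnP p N) => [pN|]; last first.
  by apply: leq_trans; rewrite -[X in _ <= X](size_iota 0 N) find_size.
rewrite -ltnS; apply: find_ltn; rewrite take_iota.
by apply/hasP; exists p; rewrite // mem_iota; lia.
Qed.

Lemma find_iotaP (P : pred nat) (N : nat) :
  find P (iota 0 N) < N -> P (find P (iota 0 N)).
Proof.
move=> fN; have nthE := nth_iota 0 0 fN; rewrite add0n in nthE.
by rewrite -[X in P X]nthE nth_find // has_find size_iota.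
Qed.

Lemma find_iota_leq (P : pred nat) (N p : nat) :
  (forall m q, m <= q -> P m -> P q) -> p < N ->
  (find P (iota 0 N) <= p) = P p.
Proof.
move=> P_up pN; apply/idP/idP => [fp|/find_iota_min//].
exact/(P_up _ _ fp)/find_iotaP/(leq_ltn_trans fp).
Qed.

Lemma last_map_iota (T : Type) (w : nat -> T) (p m : nat) :
  last (w p) (map w (iota p.+1 m)) = w (p + m).
Proof.
by rewrite last_map (last_nth 0) -[p :: _]/(iota p m.+1) nth_iota ?size_iota.
Qed.

Definition edge_run (T : Type) (e : rel T) (w : nat -> T) (p q : nat) : Prop :=
  forall c, p <= c < q -> e (w c) (w c.+1).

Lemma path_map_iota (T : Type) (e : rel T) (w : nat -> T) (p m : nat) :
  edge_run e w p (p + m) -> path e (w p) (map w (iota p.+1 m)).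
Proof.
elim: m p => [|m IH] p //= ew; rewrite ew ?IH //; last by lia.
by move=> c cm; apply: ew; lia.
Qed.

Lemma set2_eqE (T : finType) (x y a b : T) :
  ([set x; y] == [set a; b]) = (x == a) && (y == b) || (x == b) && (y == a).
Proof.
apply/eqP/orP => [E|[]/andP[/eqP -> /eqP ->] //]; last by rewrite setUC.
have := set21 x y; have := set22 x y; rewrite E => /set2P hy /set2P hx.
have := set21 a b; have := set22 a b; rewrite -E => /set2P hb /set2P ha.
by case: hx hy ha hb => ? [] ? [] ? [] ?; subst; rewrite !eqxx; auto.
Qed.

Section Walks.
Variables (T : finType) (e : rel T).

Lemma connect_crossing (A : pred T) (x y : T) :
  connect e x y -> A x -> ~~ A y -> exists u w, [/\ e u w, A u & ~~ A w].
Proof.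
case/connectP=> p + ->; elim: p x => [|z p IH] x /=; first by move=> _ ->.
case/andP=> exz pz Ax; case: (boolP (A z)) => [Az|nAz _]; first exact: IH.
by exists x, z.
Qed.

Lemma gdist_leq (x : T) (p : seq T) :
  path e x p -> gdist e x (last x p) <= size p.
Proof.
move=> pp; apply: find_iota_min; apply/existsP.
by exists (in_tuple p); rewrite /= pp eqxx.
Qed.

Lemma gdist_walk (x y : T) : gdist e x y < #|T| ->
  exists p, [/\ path e x p, last x p = y & size p = gdist e x y].
Proof.
move=> /find_iotaP/existsP[p /andP[pp /eqP lp]].
by exists p; rewrite size_tuple.
Qed.

Lemma gdist_eq1 (x y : T) : irreflexive e -> (gdist e x y == 1) = e x y.
Proof.
move=> irr; have [<-|neq] := eqVneq x y.
  by have := @gdist_leq x [::] isT; rewrite irr /= leqn0 => /eqP->.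
have T1 : 1 < #|T|.
  by rewrite -[2](_ : #|[set x; y]| = _) ?max_card // cards2 neq.
apply/eqP/idP => [d1|exy].
  have [|[|z [|? ?]] [] //=] := @gdist_walk x y; first by rewrite d1.
  - by rewrite d1.
  - by rewrite andbT => exz <-.
  - by rewrite d1.
have dle : gdist e x y <= 1 by apply: (@gdist_leq x [:: y]); rewrite /= exy.
apply/eqP; rewrite eqn_leq dle lt0n; apply/eqP => d0.
have [|p [_ lp /eqP]] := @gdist_walk x y; first by rewrite d0 ltnW.
by rewrite d0 size_eq0 => /eqP p0; rewrite -lp p0 eqxx in neq.
Qed.

End Walks.

(** * Forests *)

Section Forests.
Variables (T : finType) (e : rel T).
Hypothesis e_sym : symmetric e.
Hypothesis e_acyclic : forall c : seq T, ucycle e c -> size c <= 2.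

Definition edge_off (x : T) : rel T := [rel u w | [&& e u w, u != x & w != x]].

Lemma connect_edge_off (x u : T) (p : seq T) :
  path e u p -> x \notin u :: p -> connect (edge_off x) u (last u p).
Proof.
move=> pp xN; apply: path_connect (mem_last u p).
have off_x : {in predC1 x &, subrel e (edge_off x)}.
  by move=> w z; rewrite !inE /edge_off /= => wx zx ->; rewrite wx.
apply: (sub_in_path off_x) pp.
by apply/allP => w; apply: contraTneq => ->.
Qed.

Lemma forest_neighbor_unique (x a b : T) :
  e x a -> e x b -> x != a -> connect (edge_off x) a b -> a = b.
Proof.
move=> exa exb xa /connectP[p /shortenP[s off_s uniq_s _] b_last].
have path_s : path e a s by apply: sub_path off_s => u w /and3P[].
have xs : x \notin a :: s.
  rewrite inE negb_or xa; apply/negP => /(nthP x)[i i_s nth_i].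
  by have /(pathP x)/(_ i i_s)/and3P[_ _] := off_s; rewrite nth_i eqxx.
have /e_acyclic : ucycle e [:: x, a & s].
  apply/andP; split; last by rewrite cons_uniq xs.
  by rewrite /= exa rcons_path path_s -b_last e_sym exb.
by case: s b_last {off_s uniq_s path_s xs}.
Qed.

Lemma forest_path_unique (x : T) (p q : seq T) :
  path e x p -> path e x q -> uniq (x :: p) -> uniq (x :: q) ->
  last x p = last x q -> p = q.
Proof.
elim: p x q => [|a p IH] x [|b q] //=.
- by move=> _ _ _ /andP[xN _] x_last; rewrite {1}x_last mem_last in xN.
- by move=> _ _ /andP[xN _] _ x_last; rewrite -{1}x_last mem_last in xN.
move=> /andP[exa pa] /andP[exb qb] /andP[xp up] /andP[xq uq] same_last.
suff ab : a = b by rewrite -ab in qb uq same_last *; rewrite (IH a q).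
apply: (forest_neighbor_unique exa exb).
  by apply: contraNneq xp => ->; exact: mem_head.
apply: connect_trans (connect_edge_off pa xp) _.
rewrite same_last sym_connect_sym ?connect_edge_off // => u w.
by rewrite /edge_off /= e_sym; congr (_ && _); rewrite andbC.
Qed.

Lemma forest_gdist (x : T) (p : seq T) :
  path e x p -> uniq (x :: p) -> gdist e x (last x p) = size p.
Proof.
move=> pp up; apply/eqP; rewrite eqn_leq gdist_leq //=.
have [|q [pq]] := @gdist_walk _ e x (last x p).
  apply: leq_ltn_trans (gdist_leq pp) _.
  by rewrite -[(size p).+1]/(size (x :: p)) -(card_uniqP up) max_card.
case: (shortenP pq) => s ps us s_q s_last <-.
rewrite -(forest_path_unique ps pp us up s_last).
by case/andP: us => _ us; apply: uniq_leq_size.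
Qed.

Lemma forest_gdist_run (w : nat -> T) (p m : nat) :
  edge_run e w p (p + m) -> {in [pred c | p <= c <= p + m] &, injective w} ->
  gdist e (w p) (w (p + m)) = m.
Proof.
move=> run w_inj; have path_w := path_map_iota run.
rewrite -last_map_iota forest_gdist ?size_map ?size_iota //.
rewrite -[_ :: _]/(map w (iota p m.+1)) map_inj_in_uniq ?iota_uniq //.
by apply: sub_in2 w_inj => c; rewrite mem_iota inE; lia.
Qed.

(* The edge from w p to w (q + m) and the detour along both runs are two paths
   with the same ends. *)
Lemma forest_parallel_runs (w : nat -> T) (p q m : nat) :
  edge_run e w p (p + m) -> edge_run e w q (q + m) -> p + m < q ->
  {in [pred c | p <= c <= q + m] &, injective w} ->
  e (w (p + m)) (w q) -> e (w p) (w (q + m)) -> m = 0.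
Proof.
move=> run_p run_q pq w_inj e_inner e_outer.
set detour := map w (iota p.+1 m ++ iota q m.+1).
have path_detour : path e (w p) detour.
  rewrite /detour map_cat cat_path last_map_iota path_map_iota //=.
  by rewrite e_inner path_map_iota.
have last_detour : last (w p) detour = w (q + m).
  by rewrite /detour map_cat last_cat /= last_map_iota.
have uniq_detour : uniq (w p :: detour).
  rewrite -[_ :: _]/(map w (iota p m.+1 ++ iota q m.+1)) map_inj_in_uniq.
    rewrite cat_uniq !iota_uniq andbT; apply/hasPn => c.
    by rewrite inE !mem_iota; lia.
  by apply: sub_in2 w_inj => c; rewrite mem_cat !mem_iota inE; lia.
have uniq_outer : uniq [:: w p; w (q + m)].
  rewrite /= andbT inE; apply/eqP => /w_inj; rewrite !inE; lia.
have /(congr1 size) := @forest_path_unique (w p) [:: w (q + m)] detour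
  (introT andP (conj e_outer isT)) path_detour uniq_outer uniq_detour
  (esym last_detour).
by rewrite size_map size_cat !size_iota /=; lia.
Qed.

End Forests.

(** * Folded paths *)

Definition enumerates (T : Type) (N : nat) (h : nat -> T) : Prop :=
  {in [pred p | p < N] &, injective h} /\ forall x, exists2 p, p < N & h p = x.

Lemma graph_iso_enumeration (T : finType) (e : rel T) (x0 : T) (N : nat)
    (r : rel nat) :
  graph_iso (fun i j : 'I_N => r i j) e <->
  exists2 h, enumerates N h
           & forall p q, p < N -> q < N -> e (h p) (h q) = r p q.
Proof.
split=> [[h h_bij h_iso]|[h [h_inj h_surj] h_iso]].
  pose h' p := oapp h x0 (insub p).
  have h'E p (pN : p < N) : h' p = h (Ordinal pN) by rewrite /h' insubT.
  exists h' => [|p q pN qN]; last by rewrite !h'E h_iso.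
  split=> [p q pN qN|x].
    by rewrite (h'E p pN) (h'E q qN) => /(bij_inj h_bij) [].
  have [g _ gK] := h_bij; exists (g x) => //.
  by rewrite (h'E _ (ltn_ord _)) -[RHS]gK; congr h; apply: val_inj.
exists (fun i : 'I_N => h i) => [|i j]; last by rewrite h_iso.
apply: inj_card_bij => [i j /h_inj inj_ij|].
  by apply/val_inj/inj_ij; rewrite inE.
apply: leq_trans (leq_image_card (fun i : 'I_N => h i) predT).
apply/subset_leq_card/subsetP => x _.
by have [p pN <-] := h_surj x; apply: (codom_f _ (Ordinal pN)).
Qed.

(* The path 0, 1, ..., N - 1 in which each edge {b, b + 1} is replaced by
   {b - d b, b + 1 + d b}. The ends of the new edge still add up to 2 b + 1,
   so an edge {i, j} determines its centre b = (i + j)./2. *)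
Definition fold_rel (d : nat -> nat) : rel nat :=
  fun i j => odd (i + j) && (minn i j + d (i + j)./2 == (i + j)./2).

Definition fold_graph (N : nat) (d : nat -> nat) : rel 'I_N :=
  fun i j => fold_rel d i j.

Arguments fold_graph : clear implicits.

Definition fold_system (N : nat) (d : nat -> nat) : Prop :=
  forall b, b.+1 < N ->
    [/\ d b <= b, b.+1 + d b < N
      & forall c, b - d b <= c <= b + d b -> c != b -> d c = 0].

Definition folded (T : finType) (e : rel T) : Prop :=
  exists N d, fold_system N d /\ graph_iso (fold_graph N d) e.

Lemma fold_rel_sym d : symmetric (fold_rel d).
Proof. by move=> p q; rewrite /fold_rel addnC minnC. Qed.

Lemma fold_relP d p q : p < q ->
  reflect (exists2 b, p + d b = b & q = b.+1 + d b) (fold_rel d p q).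
Proof.
move=> pq; apply: (iffP idP) => [/andP[pq_odd /eqP E]|[b Ep Eq]].
  by exists (p + q)./2; lia.
by rewrite /fold_rel (_ : (p + q)./2 = b); lia.
Qed.

Lemma fold_rel_center d b p q : p <= q -> p + q = b.*2.+1 ->
  fold_rel d p q = (p + d b == b).
Proof.
move=> pq E; rewrite /fold_rel (_ : (p + q)./2 = b); last lia.
by rewrite (minn_idPl pq) E /= odd_double.
Qed.

Lemma fold_rel_eq d d' p q :
  (odd (p + q) -> d (p + q)./2 = d' (p + q)./2) ->
  fold_rel d p q = fold_rel d' p q.
Proof. by rewrite /fold_rel; case: (odd _) => //= ->. Qed.

Lemma eq_replace_edge (T : finType) (g g' : rel T) (a b u v : T) :
  g =2 g' -> replace_edge g a b u v =2 replace_edge g' a b u v.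
Proof. by move=> gg' x y; rewrite /replace_edge gg'. Qed.

Lemma path_graph_fold N : @path_graph N =2 fold_graph N (fun=> 0).
Proof. by move=> i j; rewrite /path_graph /fold_graph /fold_rel; lia. Qed.

Lemma replace_edge_fold N (d : nat -> nat) δ (b b' u v : 'I_N) :
  b' = b.+1 :> nat -> d b = 0 -> u + δ = b -> v = b.+1 + δ :> nat ->
  replace_edge (fold_graph N d) b b' u v
  =2 fold_graph N [eta d with (b : nat) |-> δ].
Proof.
move=> b'E db uE vE i j; rewrite /replace_edge !set2_eqE -!(inj_eq val_inj) /=.
rewrite b'E vE /fold_graph /fold_rel /=.
by case: ((i + j)./2 =P b :> nat) => [E|off_center]; rewrite ?E ?db; lia.
Qed.

(** * Row layouts *)

Definition straddles (B : pred nat) (b p q : nat) : Prop :=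
  [/\ p + q = b.*2.+1, B b = (p < b)
    & forall c, p <= c < q -> c != b -> ~~ B c].

(* A linear configuration read row after row: B c says that a new row begins
   between the positions c and c + 1. *)
Definition row_layout (T : finType) (e : rel T) (N : nat) (h : nat -> T)
    (B : pred nat) : Prop :=
  [/\ enumerates N h,
      forall c, c.+1 < N -> ~~ B c -> e (h c) (h c.+1)
    & forall p q, p < q -> q < N -> e (h p) (h q) ->
        exists b, straddles B b p q].

Section TreeLayout.
Variables (T : finType) (e : rel T) (N : nat) (h : nat -> T) (B : pred nat).
Hypotheses (e_tree : is_tree e) (layout : row_layout e N h B).

Definition centered_edge (b δ : nat) : bool :=
  [&& δ <= b, b.+1 + δ < N & e (h (b - δ)) (h (b.+1 + δ))].

Lemma centered_edgeP p q : p < q -> q < N -> e (h p) (h q) ->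
  exists b δ, [/\ centered_edge b δ, p + δ = b & q = b.+1 + δ].
Proof.
have [_ _ edgeB] := layout; move=> pq qN epq.
have [b [E _ _]] := edgeB p q pq qN epq.
exists b, (b - p); rewrite /centered_edge (_ : b - (b - p) = p); last lia.
by rewrite (_ : b.+1 + (b - p) = q); [rewrite qN epq; split; lia|lia].
Qed.

Lemma centered_edge_straddles b δ :
  centered_edge b δ -> straddles B b (b - δ) (b.+1 + δ).
Proof.
have [_ _ edgeB] := layout; case/and3P=> δb δN /edgeB[|//|b' str]; first lia.
by have [E _ _] := str; rewrite (_ : b' = b) in str; last lia.
Qed.

Lemma centered_edge_break b δ : centered_edge b δ -> B b = (0 < δ).
Proof.
move=> edge; have [_ -> _] := centered_edge_straddles edge.
by case/and3P: edge; lia.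
Qed.

Lemma centered_edge_run b δ p q : centered_edge b δ ->
  b - δ <= p -> q <= b.+1 + δ -> (b < p) || (q <= b) -> edge_run e h p q.
Proof.
move=> edge pb qb side c c_pq; have [_ eB _] := layout.
have [_ _ noB] := centered_edge_straddles edge.
by case/and3P: edge => _ bN _; apply: eB; [|apply: noB]; lia.
Qed.

Lemma centered_edge_exists b : b.+1 < N -> exists δ, centered_edge b δ.
Proof.
move=> bN; have [[h_inj h_surj] eB _] := layout.
have [_ _ e_conn _] := e_tree; case: (boolP (B b)) => [Bb|nB]; last first.
  by exists 0; rewrite /centered_edge subn0 addn0 bN eB.
pose upto := [pred x | [exists i : 'I_N, (i <= b) && (h i == x)]].
have uptoE p : p < N -> upto (h p) = (p <= b).
  move=> pN; apply/existsP/idP => [[i /andP[ib /eqP/h_inj <-//]]|pb].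
    exact: ltn_ord.
  by exists (Ordinal pN); rewrite /= pb eqxx.
have [||u [w [euw]]] := connect_crossing (A := upto) (e_conn (h b) (h b.+1)).
- by rewrite uptoE // ltnW.
- by rewrite uptoE // ltnn.
have [p pN uE] := h_surj u; have [q qN wE] := h_surj w; subst u w.
rewrite !uptoE // -ltnNge => pb bq.
have pq : p < q := leq_ltn_trans pb bq.
have [c [δ [edge pE qE]]] := centered_edgeP pq qN euw.
have [_ _ noB] := centered_edge_straddles edge.
have cb : b = c by apply/eqP/(contraLR (noB b _)) => //; lia.
by exists δ; rewrite cb.
Qed.

Lemma centered_edge_unique b δ δ' :
  centered_edge b δ -> centered_edge b δ' -> δ = δ'.
Proof.
wlog le_δ : δ δ' / δ <= δ'.
  move=> W edge edge'; case: (leqP δ δ') => [|/ltnW] le_δ; first exact: W.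
  exact/esym/W.
have [[h_inj _] _ _] := layout; have [[e_sym _] _ _ e_acyclic] := e_tree.
move=> edge edge'; have /and3P[_ _ e_inner] := edge.
have /and3P[δ'b δ'N e_outer] := edge'.
apply/eqP; rewrite eqn_leq le_δ -subn_eq0 /=; apply/eqP.
apply: (forest_parallel_runs e_sym e_acyclic (w := h) (p := b - δ')
                             (q := b.+1 + δ)).
- by apply: (centered_edge_run edge'); lia.
- by apply: (centered_edge_run edge'); lia.
- by lia.
- by apply: sub_in2 h_inj => c; rewrite !inE; lia.
- by rewrite (_ : b - δ' + _ = b - δ) //; lia.
- by rewrite (_ : b.+1 + δ + _ = b.+1 + δ') //; lia.
Qed.

Lemma row_layout_folded : folded e.
Proof.
have [[e_sym e_irr] /card_gt0P[x0 _] _ _] := e_tree.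
have depth_ex b : exists δ, (b.+1 < N) ==> centered_edge b δ.
  by case: (boolP (b.+1 < N)) => [/centered_edge_exists//|_]; exists 0.
pose d b := xchoose (depth_ex b).
have d_edge b : b.+1 < N -> centered_edge b (d b).
  exact: implyP (xchooseP (depth_ex b)).
exists N, d; split.
  move=> b bN; have [_ _ noB] := centered_edge_straddles (d_edge b bN).
  have /and3P[db dN _] := d_edge b bN; split=> // c cb c_b.
  have cN : c.+1 < N by lia.
  by have := noB c; rewrite (centered_edge_break (d_edge c cN)) c_b; lia.
have [h_enum _ _] := layout.
apply/(graph_iso_enumeration e x0); exists h => // p q pN qN.
wlog pq : p q pN qN / p < q.
  move=> W; case: (ltngtP p q) => [|qp|->]; first exact: W.
    by rewrite e_sym fold_rel_sym W.
  by rewrite e_irr /fold_rel addnn odd_double.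
apply/idP/(fold_relP d pq) => [epq|[b pE qE]].
  have [b [δ [edge pE qE]]] := centered_edgeP pq qN epq.
  have bN : b.+1 < N by lia.
  by exists b; rewrite -(centered_edge_unique edge (d_edge b bN)).
have bN : b.+1 < N by lia.
by case/and3P: (d_edge b bN) => _ _; rewrite -qE (_ : b - d b = p) //; lia.
Qed.

End TreeLayout.

Lemma folded_row_layout (T : finType) (e : rel T) :
  is_tree e -> folded e -> exists N h B, row_layout e N h B.
Proof.
move=> [_ /card_gt0P[x0 _] _ _] [N [d [d_fits]]].
move/(graph_iso_enumeration e x0) => [h h_enum eh].
exists N, h, [pred b | 0 < d b]; split=> // [c cN /= d0|p q pq qN].
  by rewrite eh ?(@fold_rel_center _ c) //; lia.
have pN := ltn_trans pq qN; rewrite eh // => /(fold_relP d pq)[b pE qE].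
have [|_ _ d0] := d_fits b; first lia.
exists b; split=> [||c c_pq cb] /=; [lia..|].
by rewrite d0 //; lia.
Qed.

(** * Linear configurations *)

Section Cells.
Variables (n : nat) (k : nat -> nat).

Definition is_cell (l i : nat) : bool := (1 <= l <= n) && (1 <= i <= k l).
Definition row_lengths : seq nat := [seq k l | l <- iota 1 n].
Definition cell_pos (l i : nat) : nat := flatten_index row_lengths l.-1 i.-1.
Definition row_of (p : nat) : nat := (reshape_index row_lengths p).+1.
Definition col_of (p : nat) : nat := (reshape_offset row_lengths p).+1.

Lemma nth_row_lengths l : 1 <= l <= n -> nth 0 row_lengths l.-1 = k l.
Proof.
move=> ln; rewrite (nth_map 0) ?size_iota ?nth_iota; [congr k|..]; lia.
Qed.

Lemma cell_pos_lt l i : is_cell l i -> cell_pos l i < sumn row_lengths.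
Proof.
by case/andP=> ln ik; apply: flatten_indexP; rewrite nth_row_lengths //; lia.
Qed.

Lemma row_of_cell l i : is_cell l i -> row_of (cell_pos l i) = l.
Proof.
case/andP=> ln ik; rewrite /row_of flatten_indexKl ?nth_row_lengths //; lia.
Qed.

Lemma col_of_cell l i : is_cell l i -> col_of (cell_pos l i) = i.
Proof.
case/andP=> ln ik; rewrite /col_of flatten_indexKr ?nth_row_lengths //; lia.
Qed.

Lemma is_cell_of p : p < sumn row_lengths -> is_cell (row_of p) (col_of p).
Proof.
move=> pN; have := reshape_indexP pN; have := reshape_offsetP pN.
rewrite size_map size_iota => col_lt row_lt.
have row_n : 1 <= row_of p <= n by [].
by rewrite /is_cell row_n /= -nth_row_lengths.
Qed.

Lemma cell_pos_of p : cell_pos (row_of p) (col_of p) = p.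
Proof. exact: reshape_indexK. Qed.

Lemma cell_posD l i j : 0 < i -> cell_pos l (i + j) = cell_pos l i + j.
Proof. by rewrite /cell_pos /flatten_index; lia. Qed.

Lemma cell_pos_next_row l i : 1 <= l <= n -> 0 < k l -> 0 < i ->
  cell_pos l.+1 i = cell_pos l (k l) + i.
Proof.
move=> ln kl i0; have l0 : 0 < l by case/andP: ln.
rewrite /cell_pos /flatten_index /= -{1}(prednK l0) (take_nth 0).
  by rewrite sumn_rcons nth_row_lengths //; lia.
by rewrite size_map size_iota; lia.
Qed.

End Cells.

Section LinearToLayout.
Variables (T : finType) (e : rel T).
Variables (n : nat) (k : nat -> nat) (v : nat -> nat -> T).
Hypotheses (e_tree : is_tree e) (config : is_linear_configuration e n k v).

Let pos : nat -> nat -> nat := cell_pos n k.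
Let N : nat := sumn (row_lengths n k).
Let reading (p : nat) : T := v (row_of n k p) (col_of n k p).
Let row_end : pred nat := [pred c | row_of n k c != row_of n k c.+1].

Lemma reading_cell l i : is_cell n k l i -> reading (pos l i) = v l i.
Proof. by move=> li; rewrite /reading row_of_cell ?col_of_cell. Qed.

Lemma reading_cell_eq p l i :
  p < N -> is_cell n k l i -> reading p = v l i -> p = pos l i.
Proof.
have [_ [_ v_inj] _ _ _] := config => pN li.
by move/(v_inj _ _ _ _ (is_cell_of pN) li) => [<- <-]; rewrite /pos cell_pos_of.
Qed.

Lemma reading_enumerates : enumerates N reading.
Proof.
have [_ [v_surj _] _ _ _] := config.
split=> [p q pN qN /(reading_cell_eq pN (is_cell_of qN)) ->|x].
  exact: cell_pos_of.
have [l [i [li <-]]] := v_surj x.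
by exists (pos l i); [apply: cell_pos_lt|apply: reading_cell].
Qed.

Lemma row_endN l i :
  is_cell n k l i -> is_cell n k l i.+1 -> ~~ row_end (pos l i).
Proof.
move=> li li'; have i0 : 0 < i by case/andP: li; lia.
by rewrite /row_end /= -addn1 -cell_posD // addn1 !row_of_cell // negbK.
Qed.

Lemma row_end_last l :
  1 <= l < n -> 0 < k l -> 0 < k l.+1 -> row_end (pos l (k l)).
Proof.
move=> ln kl kl'; rewrite /row_end /= -addn1 -cell_pos_next_row //; last lia.
by rewrite !row_of_cell ?ltn_eqF //; apply/andP; split; lia.
Qed.

Lemma reading_row_edge c :
  c.+1 < N -> ~~ row_end c -> e (reading c) (reading c.+1).
Proof.
move=> cN /negPn/eqP same_row; have [_ _ v_row _ _] := config.
have c_cell := is_cell_of (ltnW cN); have c'_cell := is_cell_of cN.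
have next_col : col_of n k c.+1 = (col_of n k c).+1.
  have := cell_pos_of n k c; have := cell_pos_of n k c.+1.
  by rewrite -same_row /cell_pos /flatten_index /row_of /col_of /=; lia.
rewrite /reading -same_row next_col; apply: v_row => //.
by rewrite -next_col same_row.
Qed.

Lemma gdist_row l i j : is_cell n k l i -> is_cell n k l j -> i <= j ->
  gdist e (v l i) (v l j) = j - i.
Proof.
have [_ [_ v_inj] v_row _ _] := config.
have [[e_sym _] _ _ e_acyclic] := e_tree.
move=> li lj ij; have interval c : i <= c <= j -> is_cell n k l c.
  move=> cij; case/andP: li => ln ik; case/andP: lj => _ jk.
  by rewrite /is_cell ln; lia.
rewrite -{1}(subnKC ij); apply: (forest_gdist_run e_sym e_acyclic (w := v l)).
  by move=> c cij; apply: v_row; apply: interval; lia.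
move=> c c'; rewrite !inE subnKC // => cij c'ij /v_inj.
by case/(_ (interval _ cij) (interval _ c'ij)).
Qed.

Lemma link_straddles l i j :
  is_cell n k l i -> is_cell n k l.+1 j -> e (v l i) (v l.+1 j) ->
  straddles row_end (pos l (k l)) (pos l i) (pos l.+1 j).
Proof.
move=> li lj elink; have [k_gt0 _ _ _ v_link] := config.
case/andP: (li) => ln ik; case/andP: (lj) => ln' jk.
have [k0 k0'] : 0 < k l /\ 0 < k l.+1 by split; apply: k_gt0.
have [] := v_link l i j li lj elink.
rewrite !gdist_row //; try by rewrite /is_cell ?ln ?ln' //; lia.
move=> dist_eq j1; have i0 : 0 < i by case/andP: ik.
have pos_last : pos l (k l) = pos l i + (k l - i).
  by rewrite /pos -cell_posD // subnKC //; case/andP: ik.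
have pos_next c : 0 < c -> pos l.+1 c = pos l (k l) + c.
  by move=> c0; rewrite /pos cell_pos_next_row.
split.
- by rewrite pos_next //; lia.
- by rewrite row_end_last //; lia.
move=> c c_pq; rewrite pos_next in c_pq; last lia.
case: ltngtP => // side _.
  have -> : c = pos l (i + (c - pos l i)).
    by rewrite /pos cell_posD // -/pos; lia.
  by apply: row_endN; rewrite /is_cell ln; lia.
have -> : c = pos l.+1 (c - pos l (k l)) by rewrite pos_next; lia.
by apply: row_endN; rewrite /is_cell ln'; lia.
Qed.

Lemma row_straddles l i : is_cell n k l i -> is_cell n k l i.+1 ->
  straddles row_end (pos l i) (pos l i) (pos l i.+1).
Proof.
move=> li li'; have pos_next : pos l i.+1 = (pos l i).+1.
  by rewrite /pos -addn1 cell_posD ?addn1 //; case/andP: li; lia.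
by split=> [||c]; rewrite ?pos_next ?ltnn; [lia|exact/negbTE/row_endN|lia].
Qed.

Lemma reading_set2 p q l i l' j : p < N -> q < N -> p < q ->
  is_cell n k l i -> is_cell n k l' j -> pos l i < pos l' j ->
  [set reading p; reading q] = [set v l i; v l' j] ->
  p = pos l i /\ q = pos l' j.
Proof.
move=> pN qN pq li lj pos_lt /eqP.
rewrite set2_eqE => /orP[]/andP[/eqP hp /eqP hq].
  by rewrite (reading_cell_eq pN li hp) (reading_cell_eq qN lj hq).
by have := reading_cell_eq pN lj hp; have := reading_cell_eq qN li hq; lia.
Qed.

Lemma reading_edge p q : p < q -> q < N -> e (reading p) (reading q) ->
  exists b, straddles row_end b p q.
Proof.
have [k_gt0 _ _ v_edge _] := config; move=> pq qN epq.
have pN := ltn_trans pq qN.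
have [l [i [[li [lj pq_set]]|[j [li [lj pq_set]]]]]] := v_edge _ _ epq.
  have str := row_straddles li lj; have [E _ _] := str.
  have [|-> ->] := reading_set2 pN qN pq li lj _ pq_set; first lia.
  by exists (pos l i).
have [/andP[ln ik] /andP[_ jk]] : is_cell n k l i /\ is_cell n k l.+1 j by [].
have pos_lt : pos l i < pos l.+1 j.
  rewrite /pos cell_pos_next_row ?(k_gt0 l) //; last by case/andP: jk.
  by rewrite -(subnKC (proj2 (andP ik))) cell_posD; [|case/andP: ik]; lia.
have [Ep Eq] := reading_set2 pN qN pq li lj pos_lt pq_set.
exists (pos l (k l)); rewrite Ep Eq; apply: link_straddles => //.
by rewrite -!reading_cell // -Ep -Eq.
Qed.

Lemma linear_row_layout : row_layout e N reading row_end.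
Proof.
split; [exact: reading_enumerates|exact: reading_row_edge|exact: reading_edge].
Qed.

End LinearToLayout.

Definition row_index (B : pred nat) (p : nat) : nat := count B (iota 0 p).

Section RowIndex.
Variable B : pred nat.

Lemma row_indexD p m : row_index B (p + m) = row_index B p + count B (iota p m).
Proof. by rewrite /row_index iotaD count_cat. Qed.

Lemma row_indexS p : row_index B p.+1 = row_index B p + B p.
Proof. by rewrite -addn1 row_indexD /= addn0. Qed.

Lemma row_index_leq p q : p <= q -> row_index B p <= row_index B q.
Proof. by move=> pq; rewrite -(subnKC pq) row_indexD leq_addr. Qed.

Lemma row_index_eqP p q : p <= q ->
  reflect (forall c, p <= c < q -> ~~ B c) (row_index B q == row_index B p).
Proof.
move=> pq; rewrite -[in row_index B q](subnKC pq) row_indexD.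
rewrite -[in X in _ == X](addn0 (row_index B p)) eqn_add2l eqn0Ngt -has_count.
apply: (iffP hasPn) => noB c.
  by move=> cpq; apply: noB; rewrite mem_iota subnKC.
by rewrite mem_iota subnKC //; apply: noB.
Qed.

Lemma straddles_rows b p q : p < q -> straddles B b p q ->
  [/\ row_index B b = row_index B p, row_index B q = row_index B b.+1
    & row_index B b.+1 = row_index B p + (p < b)].
Proof.
move=> pq [E Bb noB].
have row_b : row_index B b = row_index B p.
  by apply/eqP/row_index_eqP => [|c cb]; [|apply: noB]; lia.
have row_q : row_index B q = row_index B b.+1.
  by apply/eqP/row_index_eqP => [|c cb]; [|apply: noB]; lia.
by split=> //; rewrite row_indexS Bb row_b.
Qed.

End RowIndex.

Section LayoutToLinear.
Variables (T : finType) (e : rel T) (N : nat) (h : nat -> T) (B : pred nat).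
Hypotheses (e_tree : is_tree e) (layout : row_layout e N h B).

Let row : nat -> nat := row_index B.
Let row_start (l : nat) : nat := find (fun p => l <= (row p).+1) (iota 0 N).
Let n : nat := (row N.-1).+1.
Let k (l : nat) : nat := row_start l.+1 - row_start l.
Let v (l i : nat) : T := h (row_start l + i.-1).

Lemma layout_size_gt0 : 0 < N.
Proof.
have [_ /card_gt0P[x _] _ _] := e_tree; have [[_ h_surj] _ _] := layout.
by have [p pN _] := h_surj x; apply: leq_ltn_trans pN.
Qed.

Lemma row_start_leq l p : p < N -> (row_start l <= p) = (l <= (row p).+1).
Proof.
apply: (find_iota_leq (P := fun p => l <= (row p).+1)) => q r qr.
by move/leq_trans; apply; rewrite ltnS row_index_leq.
Qed.

Lemma row_start_size l : row_start l <= N.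
Proof. by rewrite -[X in _ <= X](size_iota 0 N) find_size. Qed.

Lemma is_cellE l i : is_cell n k l i =
  [&& 0 < l, 0 < i, row_start l + i.-1 < N & row (row_start l + i.-1) == l.-1].
Proof.
rewrite /is_cell /k; apply/andP/and4P => [[ln ik]|[l0 i0 pN row_p]].
  have pN : row_start l + i.-1 < N by have := row_start_size l.+1; lia.
  have := row_start_leq l pN; have := row_start_leq l.+1 pN.
  by split=> //; lia.
have := row_start_leq l pN; have := row_start_leq l.+1 pN.
have : row (row_start l + i.-1) <= row N.-1 by apply: row_index_leq; lia.
by rewrite /n; split; lia.
Qed.

Lemma pos_cell p : p < N ->
  exists2 i, is_cell n k (row p).+1 i & row_start (row p).+1 + i.-1 = p.
Proof.
move=> pN; have start_p : row_start (row p).+1 <= p by rewrite row_start_leq.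
by exists (p - row_start (row p).+1).+1; rewrite ?is_cellE /= subnKC // pN eqxx.
Qed.

Lemma row_start_break b : b.+1 < N -> B b -> row_start (row b).+2 = b.+1.
Proof.
move=> bN Bb; apply/eqP; rewrite eqn_leq row_start_leq // /row row_indexS Bb.
by rewrite addn1 leqnn ltnNge row_start_leq ?ltnn //; lia.
Qed.

Lemma is_cell_first l : 1 <= l <= n -> is_cell n k l 1.
Proof.
move=> ln; have start_lt : row_start l < N.
  have N_gt0 := layout_size_gt0.
  by apply: (@leq_ltn_trans N.-1); [rewrite row_start_leq|]; lia.
have start_l := row_start_leq l start_lt; rewrite leqnn in start_l.
rewrite is_cellE addn0 start_lt.
suff : row (row_start l) <= l.-1 by lia.
case: (row_start l) start_lt (row_start_leq l) => [|p] pN start_leq.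
  by rewrite /row /row_index /=; lia.
have := start_leq p (ltnW pN); rewrite ltnn => /esym.
by rewrite /row row_indexS -/row; lia.
Qed.

Lemma layout_cell_inj l i l' i' : is_cell n k l i -> is_cell n k l' i' ->
  v l i = v l' i' -> l = l' /\ i = i'.
Proof.
have [[h_inj _] _ _] := layout; rewrite !is_cellE.
move=> /and4P[l0 i0 pN /eqP row_p] /and4P[l'0 i'0 p'N /eqP row_p'].
move/(h_inj _ _ pN p'N) => pos_eq.
by have ll' : l = l' by [rewrite pos_eq in row_p; lia]; subst l'; lia.
Qed.

Lemma layout_row_edge l i :
  is_cell n k l i -> is_cell n k l i.+1 -> e (v l i) (v l i.+1).
Proof.
have [_ eB _] := layout; rewrite !is_cellE.
move=> /and4P[l0 i0 pN /eqP row_p] /and4P[_ _ p'N /eqP row_p'].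
have next : row_start l + i.+1.-1 = (row_start l + i.-1).+1 by lia.
rewrite /v next in p'N row_p' *; apply: eB => //.
by move: row_p'; rewrite /row row_indexS -/row; lia.
Qed.

Lemma layout_edge_cells p q : p < q -> q < N -> e (h p) (h q) ->
  exists l i l' j,
    [/\ is_cell n k l i, is_cell n k l' j, h p = v l i, h q = v l' j
      & l' = l /\ j = i.+1 \/ l' = l.+1].
Proof.
have [_ _ edgeB] := layout; move=> pq qN epq.
have pN := ltn_trans pq qN; have [b str] := edgeB p q pq qN epq.
have [row_b row_q row_b'] := straddles_rows pq str; have [E _ _] := str.
have [i p_cell pos_p] := pos_cell pN; have [j q_cell pos_q] := pos_cell qN.
exists (row p).+1, i, (row q).+1, j.
split=> //; try by rewrite /v ?pos_p ?pos_q.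
rewrite /row row_q row_b'; case: (ltnP p b) => pb.
  by right; rewrite addn1.
left; rewrite addn0; split=> //; move: p_cell q_cell pos_p pos_q.
by rewrite !is_cellE /row row_q row_b' (leq_gtF pb) addn0; lia.
Qed.

Lemma layout_edge x y : e x y -> exists l i,
  (is_cell n k l i /\ is_cell n k l i.+1 /\
     [set x; y] = [set v l i; v l i.+1]) \/
  (exists j, is_cell n k l i /\ is_cell n k l.+1 j /\
     [set x; y] = [set v l i; v l.+1 j]).
Proof.
have [[_ h_surj] _ _] := layout; have [[e_sym e_irr] _ _ _] := e_tree.
have [p pN <-] := h_surj x; have [q qN <-] := h_surj y.
wlog pq : p q pN qN / p < q.
  move=> W; case: (ltngtP p q) => [|qp|->]; [exact: W| |by rewrite e_irr].
  by rewrite e_sym setUC; apply: W.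
move=> /(layout_edge_cells pq qN)[l [i [l' [j [li lj -> ->]]]]].
by case=> [[El Ej]|El]; subst; exists l, i; [left|right; exists j].
Qed.

Lemma gdist_unbroken p q :
  p <= q -> q < N -> (forall c, p <= c < q -> ~~ B c) ->
  gdist e (h p) (h q) = q - p.
Proof.
have [[h_inj _] eB _] := layout; have [[e_sym _] _ _ e_acyclic] := e_tree.
move=> pq qN noB; rewrite -{1}(subnKC pq).
apply: (forest_gdist_run e_sym e_acyclic); rewrite subnKC //.
  by move=> c cpq; apply: eB; [lia|apply: noB].
by apply: sub_in2 h_inj => c; rewrite !inE; lia.
Qed.

Lemma layout_link l i j : is_cell n k l i -> is_cell n k l.+1 j ->
  e (v l i) (v l.+1 j) ->
  gdist e (v l i) (v l (k l)) = gdist e (v l.+1 1) (v l.+1 j) /\ 1 < j.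
Proof.
have [_ _ edgeB] := layout; rewrite !is_cellE.
move=> /and4P[l0 i0 pN /eqP row_p] /and4P[_ j0 qN /eqP row_q].
rewrite /v; set p := _ + i.-1 in pN row_p *; set q := _ + j.-1 in qN row_q *.
have pq : p < q.
  by rewrite ltnNge; apply/negP => /(row_index_leq B); rewrite -/row; lia.
move=> /(edgeB p q pq qN)[b str].
have [row_b row_q' row_b'] := straddles_rows pq str; have [E Bb noB] := str.
rewrite -/row in row_b row_q' row_b'.
have pb : p < b by lia.
have start_next : row_start l.+1 = b.+1.
  have -> : l.+1 = (row b).+2 by lia.
  by apply: row_start_break; lia.
rewrite start_next (_ : row_start l + (k l).-1 = b) ?addn0; last first.
  by rewrite /k start_next; lia.
have -> : gdist e (h p) (h b) = b - p.
  by apply: gdist_unbroken => [||c cb]; [lia|lia|apply: noB; lia].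
have -> : gdist e (h b.+1) (h q) = q - b.+1.
  by apply: gdist_unbroken => [||c cb]; [lia|lia|apply: noB; lia].
by lia.
Qed.

Lemma row_layout_linear : admits_linear_configuration e.
Proof.
have [[_ h_surj] _ _] := layout; exists n, k, v; split.
- by move=> l /is_cell_first/andP[_ /andP[]].
- split=> [x|]; last exact: layout_cell_inj.
  have [p pN <-] := h_surj x; have [i li pos_p] := pos_cell pN.
  by exists (row p).+1, i; rewrite /v pos_p.
- exact: layout_row_edge.
- exact: layout_edge.
- exact: layout_link.
Qed.

End LayoutToLinear.

Lemma linear_configuration_foldedP (T : finType) (e : rel T) :
  is_tree e -> admits_linear_configuration e <-> folded e.
Proof.
move=> e_tree; split=> [[n [k [v config]]]|].
  exact: row_layout_folded e_tree (linear_row_layout e_tree config).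
case/(folded_row_layout e_tree) => N [h [B]].
exact: row_layout_linear.
Qed.

(** * Walks in the grid and their corners *)

Definition adjacent (a b : nat * nat) : bool :=
  (a.1 == b.1) && ((a.2.+1 == b.2) || (b.2.+1 == a.2)) ||
  ((a.1.+1 == b.1) || (b.1.+1 == a.1)) && (a.2 == b.2).

Lemma adjacentC : symmetric adjacent.
Proof. by move=> a b; rewrite /adjacent; lia. Qed.

Lemma common_neighbors (p q x y : nat * nat) : p != q -> x != y ->
  adjacent x p -> adjacent x q -> adjacent y p -> adjacent y q ->
  x.1 + y.1 = p.1 + q.1 /\ x.2 + y.2 = p.2 + q.2.
Proof.
case: p q x y => [p1 p2] [q1 q2] [x1 x2] [y1 y2].
rewrite /adjacent !xpair_eqE /=.
by move=> pq xy /orP[]xp /orP[]xq; lia.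
Qed.

Lemma common_neighbors_leq2 (p q x y z : nat * nat) : p != q ->
  all (adjacent p) [:: x; y; z] -> all (adjacent q) [:: x; y; z] ->
  ~~ uniq [:: x; y; z].
Proof.
rewrite /= !andbT !(adjacentC p) !(adjacentC q) => pq.
move=> /and3P[xp yp zp] /and3P[xq yq zq].
rewrite !inE negb_or -!andbA; apply/negP => /and3P[xy xz yz].
have [Exy1 Exy2] := common_neighbors pq xy xp xq yp yq.
have [Exz1 Exz2] := common_neighbors pq xz xp xq zp zq.
case/eqP: yz; rewrite [LHS]surjective_pairing [RHS]surjective_pairing.
by congr pair; lia.
Qed.

Definition grid_walk (N : nat) (P : nat -> nat * nat) : Prop :=
  (forall i, i.+1 < N -> adjacent (P i) (P i.+1)) /\
  {in [pred i | i < N] &, injective P}.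

Definition horizontal (P : nat -> nat * nat) : pred nat :=
  [pred i | (P i).2 == (P i.+1).2].

Definition corner (N : nat) (P : nat -> nat * nat) : pred nat :=
  [pred i | [|| i == 0, i == N.-1 | horizontal P i.-1 != horizontal P i]].

Definition cornerless (N : nat) (P : nat -> nat * nat) (s t : nat) : Prop :=
  forall c, s < c < t -> ~~ corner N P c.

Lemma cornerless_side N P s t c : cornerless N P s t -> corner N P c ->
  c <= s \/ t <= c.
Proof.
move=> nc cc; case: (leqP c s) => [|sc]; [by left|right].
by rewrite leqNgt; apply/negP => ct; have := nc c; rewrite sc ct cc => /(_ isT).
Qed.

Lemma eq_between (A : Type) (F : nat -> A) (s t : nat) :
  (forall i, s <= i < t -> F i.+1 = F i) -> forall i, s <= i <= t -> F i = F s.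
Proof.
move=> step; elim=> [|i IH] si; first by congr F; lia.
have [->//|neq] := eqVneq s i.+1.
by rewrite step ?IH //; lia.
Qed.

Section GridWalks.
Variables (N : nat) (P : nat -> nat * nat).
Hypothesis walk : grid_walk N P.

Lemma grid_walk_step i : i.+1 < N ->
  if horizontal P i
  then (P i).2 = (P i.+1).2 /\
       ((P i.+1).1 = (P i).1.+1 \/ (P i).1 = (P i.+1).1.+1)
  else (P i).1 = (P i.+1).1 /\
       ((P i.+1).2 = (P i).2.+1 \/ (P i).2 = (P i.+1).2.+1).
Proof.
have [adj _] := walk; move/adj; rewrite /adjacent /horizontal /=.
by case: ((P i).2 =P (P i.+1).2) => /=; lia.
Qed.

Lemma cornerless_horizontal s t i j : t < N -> cornerless N P s t ->
  s <= i < t -> s <= j < t -> horizontal P i = horizontal P j.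
Proof.
move=> tN nc it jt.
have const m : s <= m <= t.-1 -> horizontal P m = horizontal P s.
  apply: eq_between => c ct; have := nc c.+1; rewrite /corner /=.
  case: eqP => //= [|_]; first by lia.
  by case: (horizontal P c) (horizontal P c.+1) => [] []; lia.
by rewrite (const i) ?(const j) //; lia.
Qed.

Lemma straight_cornerless s t : s <= t -> t < N ->
  (forall i, s <= i <= t -> (P i).1 = (P s).1) \/
  (forall i, s <= i <= t -> (P i).2 = (P s).2) <-> cornerless N P s t.
Proof.
move=> st tN; split=> [line c ct|nc].
  have [o same_dir] : exists o, forall i, s <= i < t -> horizontal P i = o.
    case: line => line; [exists false|exists true] => i it.
      have iN : i.+1 < N by lia.
      have := grid_walk_step iN.
      by case: (horizontal P i) (line i) (line i.+1) => //=; lia.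
    by apply/eqP; rewrite !line //; lia.
  by rewrite /corner /= !same_dir; lia.
have step i : s <= i < t ->
    if horizontal P s then (P i.+1).2 = (P i).2 else (P i.+1).1 = (P i).1.
  move=> it; have iN : i.+1 < N by lia.
  have := grid_walk_step iN.
  rewrite (@cornerless_horizontal s t i s) //; last lia.
  by case: (horizontal P s); lia.
move: step; case: (horizontal P s) => step; [right|left].
  exact: (eq_between (F := fun i => (P i).2)).
exact: (eq_between (F := fun i => (P i).1)).
Qed.

Lemma horizontal_run s t : s <= t -> t < N ->
  (forall i, s <= i < t -> horizontal P i) ->
  (P t).2 = (P s).2 /\
  ((P t).1 = (P s).1 + (t - s) \/ (P t).1 + (t - s) = (P s).1).
Proof.
have [_ P_inj] := walk; move=> st tN hor.
set right := [pred i | (P i).1 < (P i.+1).1].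
have row_const i : s <= i <= t -> (P i).2 = (P s).2.
  by apply: (eq_between (F := fun i => (P i).2)) => c /hor/eqP.
have step i : s <= i < t ->
    if right i then (P i.+1).1 = (P i).1.+1 else (P i).1 = (P i.+1).1.+1.
  move=> it; have iN : i.+1 < N by lia.
  by have := grid_walk_step iN; rewrite hor //=; case: ltnP; lia.
have same_side i : s <= i <= t.-1 -> right i = right s.
  apply: eq_between => c ct.
  have [ct1 ct2] : s <= c < t /\ s <= c.+1 < t by lia.
  have := step c ct1; have := step c.+1 ct2.
  have no_return : (P c.+2).1 <> (P c).1.
    move=> col_eq; suff : c.+2 = c by lia.
    apply: P_inj; rewrite ?inE; [lia..|].
    rewrite [P c.+2]surjective_pairing [P c]surjective_pairing col_eq.
    by rewrite !row_const //; lia.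
  by case: (right c) (right c.+1) => [] []; lia.
split; first by apply: row_const; lia.
case: (boolP (right s)) => side; [left|right].
  have /(_ t) : forall i, s <= i <= t -> (P i).1 + (t - i) = (P s).1 + (t - s).
    apply: (eq_between (F := fun i => (P i).1 + (t - i))) => c ct.
    by have := step c ct; rewrite same_side ?side; lia.
  by lia.
have /(_ t) : forall i, s <= i <= t -> (P i).1 + i = (P s).1 + s.
  apply: (eq_between (F := fun i => (P i).1 + i)) => c ct.
  by have := step c ct; rewrite same_side ?(negbTE side); lia.
by lia.
Qed.

End GridWalks.

Definition transpose (P : nat -> nat * nat) (i : nat) : nat * nat :=
  ((P i).2, (P i).1).

Lemma grid_walk_transpose N P : grid_walk N P -> grid_walk N (transpose P).
Proof.
case=> adj P_inj; split=> [i /adj|i j iN jN [E2 E1]].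
  by rewrite /adjacent /=; lia.
apply: P_inj => //.
by rewrite [LHS]surjective_pairing [RHS]surjective_pairing E1 E2.
Qed.

Lemma horizontal_transpose N P i : grid_walk N P -> i.+1 < N ->
  horizontal (transpose P) i = ~~ horizontal P i.
Proof.
move=> walk iN; have := grid_walk_step walk iN.
by rewrite /horizontal /=; case: eqP => _ /=; lia.
Qed.

Lemma corner_transpose N P i : grid_walk N P -> i < N ->
  corner N (transpose P) i = corner N P i.
Proof.
move=> walk iN; rewrite /corner /=; case: eqP => //= i0; case: eqP => //= iN'.
rewrite !(horizontal_transpose walk); [|lia..].
by case: (horizontal P _) (horizontal P i) => [] [].
Qed.

(* If the walk turns the same way at both ends of {b, b + 1}, the runs before
   and after it mirror each other; otherwise only the ends of the edge itself
   are adjacent. *)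
Lemma adjacent_across_edge N P b u v : grid_walk N P ->
  corner N P b -> corner N P b.+1 ->
  cornerless N P u b -> cornerless N P b.+1 v ->
  u <= b -> b < v < N -> adjacent (P u) (P v) -> u + v = b.*2.+1.
Proof.
move=> walk corner_b corner_b1 before after ub bv; have bN : b.+1 < N by lia.
wlog vertical : P walk corner_b corner_b1 before after / ~~ horizontal P b.
  move=> W; case: (boolP (horizontal P b)) => [hor|]; last exact: W.
  move=> adj; apply: (W (transpose P)) => //.
  - exact: grid_walk_transpose.
  - by rewrite (corner_transpose walk) //; lia.
  - by rewrite (corner_transpose walk) //; lia.
  - by move=> c cub; rewrite (corner_transpose walk); [apply: before|lia].
  - by move=> c cbv; rewrite (corner_transpose walk); [apply: after|lia].
  - by rewrite (horizontal_transpose walk bN) negbK.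
  - by move: adj; rewrite /adjacent /=; lia.
have hor_before i : u <= i < b -> horizontal P i.
  move=> iub; rewrite (@cornerless_horizontal N P u b i b.-1) //; try lia.
  by move: corner_b; rewrite /corner /= (negbTE vertical) eqbF_neg negbK; lia.
have hor_after i : b.+1 <= i < v -> horizontal P i.
  move=> ibv; rewrite (@cornerless_horizontal N P b.+1 v i b.+1) //; try lia.
  by move: corner_b1; rewrite /corner /= (negbTE vertical); lia.
have [b_v vN] := andP bv; have := grid_walk_step walk bN.
have := horizontal_run walk ub (ltnW bN) hor_before.
have := horizontal_run walk b_v vN hor_after.
by rewrite (negbTE vertical) /adjacent; lia.
Qed.

Definition grid_fold (N : nat) (P : nat -> nat * nat) (b δ : nat) : Prop :=
  [/\ 0 < δ <= b /\ b.+1 + δ < N, corner N P b /\ corner N P b.+1,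
      cornerless N P (b - δ) b, cornerless N P b.+1 (b.+1 + δ)
    & adjacent (P (b - δ)) (P (b.+1 + δ))].

(* Otherwise b, b + 2 and b + 4 are common neighbours of b + 1 and b + 3. *)
Lemma no_consecutive_unit_folds N P b : grid_walk N P -> b.+4 < N ->
  adjacent (P b) (P b.+3) -> ~~ adjacent (P b.+1) (P b.+4).
Proof.
case=> adj P_inj bN adj03; apply/negP => adj14.
have neq i j : i < N -> j < N -> i != j -> P i != P j.
  by move=> iN jN; apply: contraNneq => /(P_inj _ _ iN jN)/eqP.
have next i : i < b.+4 -> adjacent (P i) (P i.+1).
  by move=> ib; apply: adj; lia.
have prev i : i < b.+4 -> adjacent (P i.+1) (P i).
  by rewrite adjacentC; apply: next.
have /negP[] : ~~ uniq [:: P b; P b.+2; P b.+4].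
  apply: (@common_neighbors_leq2 (P b.+1) (P b.+3)); first by apply: neq; lia.
    by rewrite /= prev ?next ?adj14 //; lia.
  by rewrite /= [adjacent _ (P b)]adjacentC adj03 prev ?next //; lia.
by rewrite /= !inE negb_or !neq //; lia.
Qed.

(* Overlapping folds have consecutive centres and depth 1. *)
Lemma grid_folds_apart N P b δ b' δ' : grid_walk N P ->
  grid_fold N P b δ -> grid_fold N P b' δ' -> b < b' ->
  b + δ < b' /\ b < b' - δ'.
Proof.
move=> walk [[δb bN] [corner_b corner_b1] _ after adj_b].
move=> [[δ'b' b'N] [corner_b' corner_b'1] before _ adj_b'] bb'.
suff : ~ (b' <= b + δ \/ b' - δ' <= b) by lia.
move=> overlap; have [b'E δE δ'E] : [/\ b' = b.+1, δ = 1 & δ' = 1].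
  have := cornerless_side after corner_b'.
  have := cornerless_side after corner_b'1.
  have := cornerless_side before corner_b.
  have := cornerless_side before corner_b1.
  by move=> *; split; lia.
have [c bE] : exists c, b = c.+1 by exists b.-1; lia.
subst b b' δ δ'; rewrite !addn1 !subn1 /= in adj_b adj_b' b'N.
by have := no_consecutive_unit_folds walk b'N adj_b; rewrite adj_b'.
Qed.

Lemma grid_irreflexive k l : irreflexive (@grid k l).
Proof.
by move=> [x y]; rewrite /grid /cartesian_product /path_graph /= !eqxx; lia.
Qed.

Section Coordinates.
Variables (n k l : nat) (f : 'I_n -> 'I_k * 'I_l) (P : nat -> nat * nat).

Definition coords_of : Prop :=
  forall i : 'I_n, P i = ((f i).1 : nat, (f i).2 : nat).

Hypothesis f_coords : coords_of.

Lemma coords_grid i j : grid (f i) (f j) = adjacent (P i) (P j).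
Proof. by rewrite !f_coords. Qed.

Lemma coords_inj (i j : 'I_n) : P i = P j -> f i = f j.
Proof.
rewrite !f_coords => -[E1 E2].
rewrite [f i]surjective_pairing [f j]surjective_pairing.
by congr pair; apply: val_inj.
Qed.

Lemma path_embeddingE : path_embedding f <-> grid_walk n P.
Proof.
split=> [[f_inj f_adj]|[adj P_inj]]; split.
- move=> i iN; have := f_adj (Ordinal (ltnW iN)) (Ordinal iN).
  by rewrite coords_grid /path_graph /= eqxx; apply.
- move=> i j iN jN E.
  by have /f_inj[] := @coords_inj (Ordinal iN) (Ordinal jN) E.
- by move=> i j E; apply/val_inj/P_inj; rewrite ?f_coords ?E //; apply: ltn_ord.
- move=> i j /orP[]/eqP E; rewrite coords_grid; last rewrite adjacentC.
    by rewrite -E; apply: adj; rewrite E.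
  by rewrite -E; apply: adj; rewrite E.
Qed.

Hypothesis walk : grid_walk n P.

Lemma straightE s : straight f s <-> s.1 <= s.2 /\ cornerless n P s.1 s.2.
Proof.
have bounded (i : nat) : s.1 <= i <= s.2 -> i < n.
  by case/andP=> _ i_s; apply: leq_ltn_trans (ltn_ord s.2).
split=> -[s12 line]; split=> //.
  apply/(straight_cornerless walk s12 (ltn_ord _)).
  case: line => line; [left|right] => i i_s.
    by rewrite (f_coords (Ordinal (bounded i i_s))) f_coords /= line.
  by rewrite (f_coords (Ordinal (bounded i i_s))) f_coords /= line.
move/(straight_cornerless walk s12 (ltn_ord _)) in line.
by case: line => line; [left|right] => i /line; rewrite !f_coords => /val_inj.
Qed.

Lemma maximal_straight_extend s a b : maximal_straight f s ->
  a <= s.1 -> s.2 <= b < n -> cornerless n P a b -> a = s.1 /\ b = s.2.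
Proof.
move=> [/straightE[s12 _] max] a_s /andP[s_b bN] nc.
have aN : a < n by lia.
have str : straight f (Ordinal aN, Ordinal bN).
  by apply/straightE; split=> //=; lia.
by have /= <- := max _ str a_s s_b.
Qed.

Lemma maximal_straightE s : 1 < n ->
  maximal_straight f s <->
  [/\ s.1 < s.2, corner n P s.1, corner n P s.2 & cornerless n P s.1 s.2].
Proof.
move=> n1; split=> [max|[s12 corner1 corner2 no_corner]].
  have [/straightE[s12 no_corner] _] := max; have s2N := ltn_ord s.2.
  have extend a b := @maximal_straight_extend s a b max.
  have proper : s.1 < s.2.
    rewrite ltn_neqAle s12 andbT; apply/eqP => s1E.
    case: (ltnP s.2.+1 n) => sN.
      by case: (extend s.1 s.2.+1); [| |move=> c|]; lia.
    by case: (extend s.1.-1 s.2); [| |move=> c|]; lia.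
  split=> //.
  - apply/negPn/negP => ncorner1; have s1_gt0 : 0 < s.1.
      by rewrite lt0n; apply: contra ncorner1; rewrite /corner /= => ->.
    case: (extend s.1.-1 s.2); [lia|lia| |lia] => c cs.
    by case: (ltngtP c s.1) => [||->//]; [lia|move=> ?; apply: no_corner; lia].
  - apply/negPn/negP => ncorner2; have s2_lt : s.2.+1 < n.
      have : s.2 != n.-1 :> nat; last lia.
      by apply: contra ncorner2; rewrite /corner /= => ->; rewrite orbT.
    case: (extend s.1 s.2.+1); [lia|lia| |lia] => c cs.
    by case: (ltngtP c s.2) => [||->//]; [move=> ?; apply: no_corner; lia|lia].
split; first by apply/straightE; split=> //; apply: ltnW.
move=> [t1 t2] /straightE[/= t12 no_corner_t] ts1 st2.
have -> : t1 = s.1.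
  by apply: ord_inj; have := cornerless_side no_corner_t corner1; lia.
have -> : t2 = s.2.
  by apply: ord_inj; have := cornerless_side no_corner_t corner2; lia.
by rewrite -surjective_pairing.
Qed.

End Coordinates.

(** * Elementary transformations are folds *)

Section Transformations.
Variables (n k l : nat) (f : 'I_n -> 'I_k * 'I_l) (P : nat -> nat * nat).
Variable L : seq ('I_n * 'I_n).
Hypotheses (f_coords : coords_of f P) (walk : grid_walk n P).
Hypothesis segs : straight_segments f L.

Lemma infix_segments La Lb Lc : infix [:: La; Lb; Lc] L ->
  [/\ La.2 = Lb.1, Lb.2 = Lc.1
    & {in [:: La; Lb; Lc], forall s, maximal_straight f s}].
Proof.
have [_ memL chain] := segs => /infixP[s1 [s2 EL]].
have [/eqP ab /eqP bc] : La.2 == Lb.1 /\ Lb.2 == Lc.1.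
  by move: chain; rewrite EL => /cat_sorted2[_ /= /and3P[-> ->]].
by split=> // s s_in; apply/memL; rewrite EL !mem_cat s_in orbT.
Qed.

Lemma elementary_transformation_fold g g' :
  elementary_transformation f L g g' ->
  exists (b b' u v : 'I_n) (δ : nat),
    [/\ [/\ b' = b.+1 :> nat, u + δ = b & v = b.+1 + δ :> nat],
        grid_fold n P b δ, g b b' & g' =2 replace_edge g b b' u v].
Proof.
case=> -[a b] [[b0 b'] [[b0' c] [u [v []]]]].
move=> /infix_segments[/= <- <- max] {b0 b0'} b'E [ua vc /eqP uv] [gb guv] g'E.
have n1 : 1 < n by have := ltn_ord b'; rewrite b'E; lia.
have ends s := proj1 (maximal_straightE f_coords walk s n1).
have [|_ _ _ before] := ends (a, b).
  by apply: max; rewrite inE eqxx.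
have [|_ corner_b corner_b' _] := ends (b, b').
  by apply: max; rewrite !inE eqxx orbT.
have [|_ _ _ after] := ends (b', c).
  by apply: max; rewrite !inE eqxx !orbT.
rewrite /in_segment /= ?b'E in corner_b corner_b' before after ua vc.
have {}before : cornerless n P u b by move=> i iu; apply: before; lia.
have {}after : cornerless n P b.+1 v by move=> i iv; apply: after; lia.
have adj_uv : adjacent (P u) (P v).
  by rewrite -(coords_grid f_coords) -gdist_eq1 //; apply: grid_irreflexive.
have [ub vN] : u <= b /\ b < v < n by have := ltn_ord v; lia.
have E :=
  adjacent_across_edge walk corner_b corner_b' before after ub vN adj_uv.
have {}ub : u < b.
  rewrite ltn_neqAle ub andbT; apply: contraNneq guv => /ord_inj uE.
  by rewrite uE in E *; rewrite (_ : v = b') //; apply: ord_inj; lia.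
exists b, b', u, v, (b - u); split=> //; first by split; lia.
have [uE vE] : b - (b - u) = u /\ b.+1 + (b - u) = v by lia.
by split; rewrite ?uE ?vE //; lia.
Qed.

Definition grid_folded (g : rel 'I_n) : Prop :=
  exists2 d, forall b, 0 < d b -> grid_fold n P b (d b) & g =2 fold_graph n d.

Lemma elementary_transformation_grid_folded g g' :
  elementary_transformation f L g g' -> grid_folded g -> grid_folded g'.
Proof.
move=> /elementary_transformation_fold[b [b' [u [v [δ]]]]].
move=> [[b'E uE vE] fold_b gb g'E] [d d_fold gE].
have db : d b = 0.
  by move: gb; rewrite gE /fold_graph b'E (@fold_rel_center _ b); lia.
exists [eta d with (b : nat) |-> δ].
  by move=> c /=; case: eqP => [->|_ /d_fold].
move=> i j; rewrite g'E -(replace_edge_fold b'E db uE vE).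
exact: eq_replace_edge.
Qed.

Lemma transformations_grid_folded g :
  clos_refl_trans _ (elementary_transformation f L) (@path_graph n) g ->
  grid_folded g.
Proof.
have base : grid_folded (@path_graph n).
  by exists (fun=> 0); last exact: path_graph_fold.
move=> trans; elim: trans base => [g1 g2|//|g1 g2 g3 _ IH12 _ IH23].
  exact: elementary_transformation_grid_folded.
by move/IH12/IH23.
Qed.

Lemma grid_folds_system d :
  (forall b, 0 < d b -> grid_fold n P b (d b)) -> fold_system n d.
Proof.
move=> d_fold b bn; case: (posnP (d b)) => db.
  by rewrite db; split=> [||c]; lia.
have [[db_b dbn] _ _ _ _] := d_fold b db; split=> [||c cb c_b]; [lia|lia|].
apply/eqP; rewrite -leqn0 leqNgt; apply/negP => dc.
case: (ltngtP b c) c_b => // bc _.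
  by have := grid_folds_apart walk (d_fold b db) (d_fold c dc) bc; lia.
by have := grid_folds_apart walk (d_fold c dc) (d_fold b db) bc; lia.
Qed.

End Transformations.

Lemma eq_graph_iso (T U : finType) (g g' : rel T) (e : rel U) :
  g =2 g' -> graph_iso g e -> graph_iso g' e.
Proof. by move=> gg' [h h_bij h_iso]; exists h => // x y; rewrite -gg'. Qed.

Lemma path_like_folded (T : finType) (e : rel T) : path_like e -> folded e.
Proof.
move=> [n [k [l [f [L [g [emb segs trans iso]]]]]]].
pose P i := oapp (fun j => ((f j).1 : nat, (f j).2 : nat)) (0, 0) (insub i).
have f_coords : coords_of f P by move=> i; rewrite /P valK.
have walk : grid_walk n P by apply/(path_embeddingE f_coords).
have [d d_fold gE] := transformations_grid_folded f_coords walk segs trans.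
exists n, d; split; first exact: grid_folds_system d_fold.
exact: eq_graph_iso iso.
Qed.

(** * Folds are elementary transformations *)

Lemma mem_pairmap_pair (x : nat) (C : seq nat) (s t : nat) : path ltn x C ->
  (s, t) \in pairmap pair x C <->
  [/\ s \in x :: C, t \in x :: C, s < t & forall c, c \in C -> ~~ (s < c < t)].
Proof.
elim: C x => [|y C IH] x /=.
  rewrite in_nil => _; split=> // -[]; rewrite !inE => /eqP-> /eqP->.
  by rewrite ltnn.
case/andP=> xy yC; have y_min c : c \in C -> y < c.
  by apply/allP; apply: (order_path_min ltn_trans).
rewrite inE; split.
  case/predU1P=> [[-> ->]|/(IH y yC)[sC tC st no_between]].
    split; rewrite ?inE ?eqxx ?orbT // => c.
    by rewrite inE => /predU1P[->|/y_min]; lia.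
  split=> //; rewrite 1?inE ?sC ?tC ?orbT // => c.
  rewrite inE => /predU1P[->|/no_between//].
  by move: sC; rewrite inE => /predU1P[->|/y_min]; lia.
case=> sC tC st no_between; have := no_between y (mem_head _ _).
move: sC; rewrite inE => /predU1P[sE|sC] y_outside.
  subst s; move: tC; rewrite inE => /predU1P[?|]; first lia.
  rewrite inE => /predU1P[->|/y_min]; first by rewrite eqxx.
  by lia.
have ys : y <= s by move: sC; rewrite inE => /predU1P[->//|/y_min]; lia.
apply/orP; right; apply/(IH y yC); split=> //.
  by move: tC; rewrite inE => /predU1P[?|//]; lia.
by move=> c cC; apply: no_between; rewrite inE cC orbT.
Qed.

Lemma map_snd_pairmap_pair (T : Type) (x : T) (C : seq T) :
  map snd (pairmap pair x C) = C.
Proof. by elim: C x => //= y C IH x; rewrite IH. Qed.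

Lemma path_pairmap_pair (T : eqType) (x y : T) (C : seq T) :
  path (fun s t : T * T => s.2 == t.1) (y, x) (pairmap pair x C).
Proof. by elim: C x y => //= z C IH x y; rewrite eqxx IH. Qed.

Section CornerSegments.
Variables (n k l : nat) (f : 'I_n.+1 -> 'I_k * 'I_l) (P : nat -> nat * nat).
Hypotheses (f_coords : coords_of f P) (walk : grid_walk n.+1 P).

Definition corners : seq nat := [seq i <- iota 1 n | corner n.+1 P i].
Definition to_ord (s : nat * nat) : 'I_n.+1 * 'I_n.+1 := (inord s.1, inord s.2).

(* For n = 0 the walk is one point, which is a maximal segment by itself
   although it does not join two distinct corners. *)
Definition corner_segments : seq ('I_n.+1 * 'I_n.+1) :=
  if n == 0 then [:: (ord0, ord0)] else map to_ord (pairmap pair 0 corners).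

Lemma corner_segmentsE : 0 < n ->
  corner_segments = map to_ord (pairmap pair 0 corners).
Proof. by rewrite /corner_segments eqn0Ngt => ->. Qed.

Lemma corners_path : path ltn 0 corners.
Proof.
have : sorted ltn (iota 0 n.+1) by apply: iota_ltn_sorted.
by move=> /(sorted_filter ltn_trans (corner n.+1 P)).
Qed.

Lemma mem_corners i : (i \in 0 :: corners) = (i <= n) && corner n.+1 P i.
Proof.
by rewrite inE mem_filter mem_iota; case: i => [|i] //=; rewrite andbC ltnS.
Qed.

Lemma cornerless_corners s t : t <= n -> cornerless n.+1 P s t <->
  forall c, c \in corners -> ~~ (s < c < t).
Proof.
move=> tn; split=> nc c; rewrite ?mem_filter.
  by case/andP=> cc _; apply: contraL cc => /nc.
move=> cst; apply: contraL (cst) => cc; apply: nc.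
by rewrite mem_filter cc mem_iota; lia.
Qed.

Lemma to_ordK s : s \in pairmap pair 0 corners ->
  ((to_ord s).1 : nat, (to_ord s).2 : nat) = s.
Proof.
case: s => s t /(mem_pairmap_pair _ _ corners_path)[].
by rewrite !mem_corners => /andP[sn _] /andP[tn _] _ _; rewrite !inordK.
Qed.

Lemma mem_map_to_ord (s : 'I_n.+1 * 'I_n.+1) :
  (s \in map to_ord (pairmap pair 0 corners)) =
  ((s.1 : nat, s.2 : nat) \in pairmap pair 0 corners).
Proof.
apply/mapP/idP => [[p p_in ->]|s_in]; first by rewrite to_ordK.
exists (s.1 : nat, s.2 : nat); first by [].
by rewrite /to_ord !inord_val -surjective_pairing.
Qed.

Lemma point_segments : n = 0 -> straight_segments f corner_segments.
Proof.
move=> n0; have ord10 (i : 'I_n.+1) : i = ord0.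
  by apply: val_inj; case: i => i /=; rewrite n0; lia.
have pair0 (s : 'I_n.+1 * 'I_n.+1) : s = (ord0, ord0).
  by rewrite [s]surjective_pairing !(ord10 _.1) !(ord10 _.2).
rewrite /corner_segments (introT eqP n0); split=> // s; split=> _; last first.
  by rewrite (pair0 s) mem_head.
split=> [|t _ _ _]; last by rewrite (pair0 s) (pair0 t).
by rewrite (pair0 s); split=> //; left=> i _; rewrite (ord10 i).
Qed.

Lemma corner_segmentsP : straight_segments f corner_segments.
Proof.
have [n0|n0] := posnP n; first exact: point_segments.
rewrite corner_segmentsE //; split.
- rewrite map_inj_in_uniq => [|s t /to_ordK {2}<- /to_ordK {2}<- -> //].
  apply: (@map_uniq _ _ snd).
  by rewrite map_snd_pairmap_pair filter_uniq ?iota_uniq.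
- move=> s; rewrite mem_map_to_ord (maximal_straightE f_coords walk s n0).
  rewrite (mem_pairmap_pair _ _ corners_path) !mem_corners !leq_ord /=.
  have no_cornerE := cornerless_corners s.1 (leq_ord s.2).
  by split=> -[? ? ? /no_cornerE].
- have chain := path_sorted (path_pairmap_pair 0 0 corners).
  rewrite sorted_map; apply: sub_sorted chain.
  by move=> s t /eqP st /=; rewrite st.
Qed.

Lemma corner_segments_infix b : 0 < b -> b.+1 < n ->
  corner n.+1 P b -> corner n.+1 P b.+1 ->
  exists a c, [/\ infix [:: to_ord (a, b); to_ord (b, b.+1); to_ord (b.+1, c)]
                        corner_segments,
                  corner n.+1 P a, corner n.+1 P c & a < b /\ b.+1 < c <= n].
Proof.
move=> b0 bn corner_b corner_b1; set Q := corner n.+1 P in corner_b corner_b1 *.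
pose A := [seq i <- iota 1 b.-1 | Q i].
pose C := [seq i <- iota b.+2 (n - b.+1) | Q i].
have cornersE : corners = A ++ [:: b, b.+1 & C].
  have -> : corners = [seq i <- iota 1 (b.-1 + (2 + (n - b.+1))) | Q i].
    by congr (filter _ (iota 1 _)); lia.
  by rewrite iotaD filter_cat add1n prednK // /C /= corner_b corner_b1.
have : n \in C by rewrite mem_filter mem_iota /Q /corner /= eqxx orbT /=; lia.
case CE : C => [|c C'] // _; have : c \in C by rewrite CE mem_head.
rewrite mem_filter mem_iota => /andP[corner_c cn].
have [corner_a ab] : Q (last 0 A) /\ last 0 A < b.
  have := mem_last 0 A; rewrite inE mem_filter mem_iota.
  by case/predU1P=> [->|/and3P[-> _]] //; rewrite add1n prednK.
exists (last 0 A), c; split=> //; last by lia.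
apply/infixP; rewrite corner_segmentsE ?cornersE ?CE; last lia.
rewrite pairmap_cat map_cat.
by exists (map to_ord (pairmap pair 0 A)), (map to_ord (pairmap pair c C')).
Qed.

Lemma grid_fold_transformation (g : rel 'I_n.+1) (b b' u v : 'I_n.+1) δ :
  b' = b.+1 :> nat -> u + δ = b -> v = b.+1 + δ :> nat ->
  grid_fold n.+1 P b δ -> g b b' -> ~~ g u v ->
  elementary_transformation f corner_segments g (replace_edge g b b' u v).
Proof.
move=> b'E uE vE [[δb bδN] [corner_b corner_b'] before after adj_uv] gb guv.
have [||a [c [inL corner_a corner_c [ab bc]]]] :=
  corner_segments_infix _ _ corner_b corner_b'; [lia|lia|].
exists (inord a, b), (b, b'), (b', inord c), u, v; split=> //.
  by move: inL; rewrite /to_ord /= -b'E !inord_val.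
have := cornerless_side before corner_a; have := cornerless_side after corner_c.
move=> c_side a_side; split; rewrite /in_segment /= ?inordK; [lia..|].
apply/eqP; rewrite gdist_eq1; last exact: grid_irreflexive.
by rewrite (coords_grid f_coords) vE (_ : nat_of_ord u = b - δ) //; lia.
Qed.

Definition reachable_fold (d : nat -> nat) : Prop :=
  exists2 g, clos_refl_trans _ (elementary_transformation f corner_segments)
                             (@path_graph n.+1) g
           & g =2 fold_graph n.+1 d.

Lemma eq_reachable_fold d d' : (forall b, b < n -> d b = d' b) ->
  reachable_fold d -> reachable_fold d'.
Proof.
move=> dd' [g trans gE]; exists g => // i j; rewrite gE.
apply: fold_rel_eq => ij_odd; apply: dd'.
by have := leq_ord i; have := leq_ord j; lia.
Qed.

Lemma reachable_fold_update (d : nat -> nat) b δ :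
  d b = 0 -> grid_fold n.+1 P b δ -> reachable_fold d ->
  reachable_fold [eta d with b |-> δ].
Proof.
move=> db fold_b [g trans gE]; have [[δb bδN] _ _ _ _] := fold_b.
have [uN bN b1N] : [/\ b - δ < n.+1, b < n.+1 & b.+1 < n.+1] by split; lia.
pose b0 := Ordinal bN; pose b1 := Ordinal b1N.
pose u := Ordinal uN; pose v := Ordinal bδN.
have g_center (i j : 'I_n.+1) :
    i <= j -> i + j = b.*2.+1 -> g i j = (i == b :> nat).
  move=> ij E; rewrite gE /fold_graph (fold_rel_center _ ij E).
  by rewrite db addn0.
have uE : u + δ = b0 by rewrite /=; lia.
exists (replace_edge g b0 b1 u v); last first.
  move=> i j; rewrite (eq_replace_edge _ _ _ _ gE).
  by rewrite (replace_edge_fold _ db uE).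
apply: rt_trans trans (rt_step _ _ _ _ _).
by apply: (grid_fold_transformation _ uE) => //; rewrite g_center /=; lia.
Qed.

Lemma grid_folds_reachable (d : nat -> nat) :
  (forall b, b < n -> 0 < d b -> grid_fold n.+1 P b (d b)) -> reachable_fold d.
Proof.
move=> d_fold; pose upto m b := if b < m then d b else 0.
suff /(_ n (leqnn n)) : forall m, m <= n -> reachable_fold (upto m).
  by apply: eq_reachable_fold => b bn; rewrite /upto bn.
elim=> [_|m IH mn].
  by exists (@path_graph n.+1); [apply: rt_refl|apply: path_graph_fold].
have uptoS b : upto m.+1 b = if b == m then d m else upto m b.
  by rewrite /upto ltnS; case: ltngtP => // ->.
have upto_m : upto m m = 0 by rewrite /upto ltnn.
have reach_m := IH (ltnW mn); case: (posnP (d m)) => dm.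
  apply: eq_reachable_fold reach_m => b _.
  by rewrite uptoS dm; case: eqP => // ->.
have := reachable_fold_update upto_m (d_fold m mn dm) reach_m.
by apply: eq_reachable_fold => b _; rewrite uptoS.
Qed.

End CornerSegments.

(** * The zigzag embedding *)

Section Zigzag.
Variables (N : nat) (d : nat -> nat).

Definition zigzag_row : nat -> nat := row_index [pred b | 0 < d b].

(* The walk turns back after each vertical step. Starting at column N keeps the
   predecessor from truncating. *)
Fixpoint zigzag_col (p : nat) : nat :=
  if p is q.+1 then
    if 0 < d q then zigzag_col q
    else if odd (zigzag_row q) then (zigzag_col q).-1 else (zigzag_col q).+1
  else N.

Definition zigzag (p : nat) : nat * nat := (zigzag_col p, zigzag_row p).

Lemma zigzag_col_bounds p : N - p <= zigzag_col p <= N + p.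
Proof.
by elim: p => [|p IH] /=; [lia|case: ifP => _; [|case: ifP => _]; lia].
Qed.

Lemma zigzag_row_bound p : zigzag_row p <= p.
Proof. by rewrite -[X in _ <= X](size_iota 0) count_size. Qed.

Lemma zigzag_rowS p : zigzag_row p.+1 = zigzag_row p + (0 < d p).
Proof. exact: row_indexS. Qed.

Lemma zigzag_row_eqP p q : p <= q ->
  reflect (forall c, p <= c < q -> d c = 0) (zigzag_row q == zigzag_row p).
Proof.
move=> pq; apply: (iffP (row_index_eqP _ pq)) => d0 c cpq.
  by have := d0 c cpq; rewrite /= -eqn0Ngt => /eqP.
by rewrite /= d0.
Qed.

Lemma zigzag_run p q : p <= q <= N -> (forall c, p <= c < q -> d c = 0) ->
  zigzag_row q = zigzag_row p /\
  if odd (zigzag_row p) then zigzag_col q + (q - p) = zigzag_col p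
  else zigzag_col q = zigzag_col p + (q - p).
Proof.
case/andP=> pq; elim: q pq => [|q IH].
  by rewrite leqn0 => /eqP-> _ _; split=> //; case: odd; lia.
rewrite leq_eqVlt ltnS => /predU1P[<- _ _|pq qN d0].
  by split=> //; case: odd; lia.
have [c cpq|row_q col_q] := IH pq (ltnW qN); first by apply: d0; lia.
have := zigzag_col_bounds q.
rewrite zigzag_rowS /= !d0 /= ?addn0 ?row_q; last lia.
by case: odd col_q => /=; lia.
Qed.

Lemma zigzag_adjacent i : i < N -> adjacent (zigzag i) (zigzag i.+1).
Proof.
move=> iN; have := zigzag_col_bounds i; rewrite /adjacent /= zigzag_rowS.
by case: (0 < d i) => /=; [|case: odd]; lia.
Qed.

Lemma zigzag_walk : grid_walk N zigzag.
Proof.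
split=> [i /ltnW/zigzag_adjacent//|].
have lt_neq i j : i < j -> j < N -> zigzag i <> zigzag j.
  move=> ij jN [col_eq /esym/eqP/(zigzag_row_eqP (ltnW ij)) d0].
  have [|_] := zigzag_run _ d0; first by lia.
  by case: odd; lia.
move=> i j iN jN E; case: (ltngtP i j) => // lt.
  by case: (lt_neq i j).
by case: (lt_neq j i).
Qed.

Lemma horizontal_zigzag i : horizontal zigzag i = (d i == 0).
Proof. by rewrite /horizontal /= zigzag_rowS; lia. Qed.

Hypothesis d_fits : fold_system N d.

Lemma zigzag_fold b : b.+1 < N -> 0 < d b -> grid_fold N zigzag b (d b).
Proof.
move=> bN db; have [d_b dbN d0] := d_fits bN.
have flat i : b - d b <= i <= b + d b -> i != b -> horizontal zigzag i.
  by move=> ib i_b; rewrite horizontal_zigzag d0.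
have bent : horizontal zigzag b = false by rewrite horizontal_zigzag; lia.
split.
- by lia.
- by split; rewrite /corner /= bent flat ?orbT //; lia.
- by move=> c cb; rewrite /corner /= !flat ?eqxx; lia.
- by move=> c cb; rewrite /corner /= !flat ?eqxx; lia.
have [||row_b col_b] := @zigzag_run (b - d b) b; first by lia.
  by move=> c cb; apply: d0; lia.
have [||row_v col_v] := @zigzag_run b.+1 (b.+1 + d b); first by lia.
  by move=> c cb; apply: d0; lia.
have row_b1 : zigzag_row b.+1 = (zigzag_row b).+1.
  by rewrite zigzag_rowS db addn1.
move: col_b col_v; rewrite /adjacent /= row_v row_b1 -row_b /= db.
by rewrite subKn // addKn; case: odd => /=; lia.
Qed.

End Zigzag.

Lemma folded_path_like (T : finType) (e : rel T) :
  0 < #|T| -> folded e -> path_like e.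
Proof.
move=> /card_gt0P[x _] [[|n] [d [d_fits iso]]].
  by case: iso => h [h' _ _] _; case: (h' x).
pose P := zigzag n.+1 d.
pose f (i : 'I_n.+1) : 'I_(n.+1 + n).+1 * 'I_n.+1 :=
  (inord (P i).1, inord (P i).2).
have f_coords : coords_of f P.
  move=> i; rewrite /f !inordK; first exact: surjective_pairing.
    by rewrite ltnS; apply: leq_trans (zigzag_row_bound d i) (leq_ord i).
  by have := zigzag_col_bounds n.+1 d i; have := leq_ord i; rewrite /=; lia.
have walk : grid_walk n.+1 P := zigzag_walk n.+1 d.
have d_fold b : b < n -> 0 < d b -> grid_fold n.+1 P b (d b).
  exact: (zigzag_fold d_fits).
have [g trans gE] := grid_folds_reachable f_coords d_fold.
exists n.+1, _, _, f, (corner_segments n P), g; split=> //.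
- exact/(path_embeddingE f_coords).
- exact: corner_segmentsP.
- by apply: eq_graph_iso iso => i j; rewrite gE.
Qed.

Theorem theorem2 (T : finType) (e : rel T) (hT : is_tree e) :
  admits_linear_configuration e <-> path_like e.
Proof.
have [_ T_gt0 _ _] := hT; split=> [/(linear_configuration_foldedP hT)|].
  exact: folded_path_like.
by move/path_like_folded/(linear_configuration_foldedP hT).
Qed.
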